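(* Let $G$ be a finite group which can be written as $G=AB$, where $A$ and $B$ are abelian subgroups of $G$ of relatively prime orders and $A$ is normal in $G$. Then $$m(G)=|A|^2\,|C_B(A)|^2 \quad\text{and}\quad \mathcal{CD}(G)=\{AC_B(A)\},$$ where $C_B(A)=\{b\in B \mid ba=ab \text{ for all } a\in A\}$.
   Context: For a finite group $G$ and a subgroup $H\le G$, the Chermak-Delgado measure of $H$ in $G$ is $m_G(H)=|H|\,|C_G(H)|$, where $C_G(H)$ is the centralizer of $H$ in $G$. Put $m(G)=\max\{m_G(H)\mid H\le G\}$ and $\mathcal{CD}(G)=\{H\le G\mid m_G(H)=m(G)\}$; the set $\mathcal{CD}(G)$ (a sublattice of the subgroup lattice of $G$) is called the Chermak-Delgado lattice of $G$. The notation $G=AB$ means that every element of $G$ is a product $ab$ with $a\in A$, $b\in B$. *)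

(* Defs.v *)
From mathcomp Require Import all_boot all_fingroup.

Set Implicit Arguments.
Unset Strict Implicit.
Unset Printing Implicit Defensive.

Local Open Scope group_scope.

Definition cd_measure (gT : finGroupType) (G H : {set gT}) : nat :=
  (#|H| * #|'C_G(H)|)%N.

Definition cd_max (gT : finGroupType) (G : {set gT}) : nat :=
  (\max_(H : {group gT} | H \subset G) cd_measure G H)%N.

Definition cd_lattice (gT : finGroupType) (G : {set gT}) : {set {group gT}} :=
  [set H : {group gT} | (H \subset G) && (cd_measure G H == cd_max G)].

(* Main.v *)
Require Import Defs.
From mathcomp Require Import all_boot all_fingroup cyclic.

Set Implicit Arguments.
Unset Strict Implicit.
Unset Printing Implicit Defensive.

Local Open Scope group_scope.

(** Write C for 'C_B(A). The whole problem reduces to one inequality on coprime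
    action: if an abelian group X normalises A and |A|, |X| are coprime, then
      |X| |'C_A(X)| <= |A| |'C_X(A)|,
    strictly unless X centralises A (coprime_abelian_cent_leqif). This is
    proved by induction on |X|: when X moves a in A, the stabiliser
    Y = 'C_X[a] is a proper subgroup, still containing 'C_X(A), and
    'C_A(Y) exceeds 'C_A(X) by a factor larger than |X : Y|. Indeed, as X is
    abelian, Y fixes all |X : Y| conjugates of a, and by coprimality these lie
    in distinct cosets of 'C_A(X), none of which is 'C_A(X) itself.

    Given H <= G = AB and K = 'C_G(H), let X = B :&: AH and Y = B :&: AK be the
    subgroups of B corresponding to the images of H and K in G / A. Then
    |H| = |X| |A :&: H| and |K| = |Y| |A :&: K|. Since A is abelian and H and K
    commute, A :&: H <= 'C_A(Y) and A :&: K <= 'C_A(X); so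
      |H| |K| <= (|X| |'C_A(X)|) (|Y| |'C_A(Y)|) <= (|A| |C|)^2.
    Equality forces X = Y = C, so H and K both lie in M = AC; then
    |H| |K| = |M|^2 gives H = M. Conversely M is abelian, so that
    M <= 'C_G(M) and the bound is attained at M. *)

(** As z fixes c, conjugating a by z ^+ n yields a * c ^+ n; taking n = |X| shows
    that the order of c divides |X| as well as |A|. *)
Lemma coprime_fixed_coset (gT : finGroupType) (A X : {group gT}) a c z :
    coprime #|A| #|X| -> a \in A -> c \in 'C_A(X) -> z \in X ->
  a ^ z = a * c -> c = 1.
Proof.
move=> coAX Aa /setIP[Ac /centP cXc] Xz azE.
have azn n : a ^ (z ^+ n) = a * c ^+ n.
  elim: n => [|n IHn]; first by rewrite !expg0 conjg1 mulg1.
  rewrite expgSr conjgM IHn conjMg azE conjXg.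
  have -> : c ^ z = c by apply/conjg_fixP/commgP/cXc.
  by rewrite -mulgA -expgS.
have cX1 : c ^+ #|X| = 1.
  apply: (mulgI a); rewrite -azn mulg1.
  have/eqP-> : z ^+ #|X| == 1 by rewrite -order_dvdn order_dvdG.
  by rewrite conjg1.
apply/eqP; rewrite -order_eq1 -dvdn1 -(eqP coAX) dvdn_gcd.
by rewrite order_dvdG // order_dvdn cX1 eqxx.
Qed.

(** The induction step of coprime_abelian_cent_leqif. The inequality is strict
    because the trivial coset of 'C_A(X) contains no conjugate of a. *)
Lemma index_mul_cent_lt (gT : finGroupType) (A X : {group gT}) a :
    abelian X -> X \subset 'N(A) -> coprime #|A| #|X| ->
    a \in A -> a \notin 'C(X) ->
  (#|X : 'C_X[a]| * #|'C_A(X)| < #|'C_A('C_X[a])|)%N.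
Proof.
move=> abX nAX coAX Aa ncXa; rewrite index_cent1.
set D := 'C_A('C_X[a]); set F := 'C_A(X).
have sFD : F \subset D by rewrite setIS // centS // subsetIl.
have aXD u : u \in a ^: X -> u \in D.
  case/imsetP=> x Xx ->; apply/setIP; split; first by rewrite memJ_norm ?(subsetP nAX).
  apply/centP=> y /setIP[Xy /cent1P cya].
  have yx : y ^ x = y by apply/conjg_fixP/commgP/(centsP abX).
  by rewrite /commute -[in LHS]yx -[in RHS]yx -!conjMg cya.
(* Products give an injection of (a ^: X) x F into D whose image omits 1. *)
pose h (p : gT * gT) := p.1 * p.2.
have injh : {in setX (a ^: X) F &, injective h}.
  case=> u f [v g] /setXP[/= aXu Ff] /setXP[/= aXv Fg]; rewrite /h /=.
  case/imsetP: aXu => x Xx ->; case/imsetP: aXv => y Xy -> eq_uf.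
  have Fgf : g * f^-1 \in F by rewrite groupM ?groupV.
  have gfJ : (g * f^-1) ^ y^-1 = g * f^-1.
    apply/conjg_fixP/commgP; case/setIP: Fgf => _ /centP; apply.
    by rewrite groupV.
  have gf1 : g * f^-1 = 1.
    apply: (coprime_fixed_coset coAX Aa Fgf (groupM Xx (groupVr Xy))).
    by rewrite conjgM -[a ^ x](mulgK f) eq_uf -mulgA conjMg conjgK gfJ.
  have gf : g = f by rewrite -[g](mulgKV f) gf1 mul1g.
  by move: eq_uf; rewrite gf => /mulIg->.
rewrite -cardsX -(card_in_imset injh) proper_card //.
apply/properP; split.
  apply/subsetP=> _ /imsetP[[u f] /setXP[/= aXu Ff] ->].
  exact: groupM (aXD _ aXu) (subsetP sFD _ Ff).
exists 1; first exact: group1.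
apply/imsetP=> -[[u f] /setXP[/= aXu Ff]]; rewrite /h /= => uf1.
have Fu : u \in F by rewrite -(groupMr _ Ff) -uf1 group1.
case/imsetP: aXu Fu => x Xx -> /setIP[_ cXax]; case/negP: ncXa.
have axK : (a ^ x) ^ x^-1 = a ^ x.
  by apply/conjg_fixP/commgP/(centP cXax); rewrite groupV.
by rewrite -[a](conjgK x) axK.
Qed.

(** Equivalently, |X : 'C_X(A)| <= |A : 'C_A(X)|: an abelian group acting
    faithfully and coprimely is no larger than the index of its fixed points. *)
Lemma coprime_abelian_cent_leqif (gT : finGroupType) (A X : {group gT}) :
    abelian X -> X \subset 'N(A) -> coprime #|A| #|X| ->
  (#|X| * #|'C_A(X)| <= #|A| * #|'C_X(A)| ?= iff (A \subset 'C(X)))%N.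
Proof.
move: {2}#|X|.+1 (ltnSn #|X|) => n; elim: n X => // n IHn X leXn abX nAX coAX.
have [cXA | /subsetPn[a Aa ncXa]] := boolP (A \subset 'C(X)).
  have cAX : X \subset 'C(A) by rewrite centsC.
  by rewrite (setIidPl cXA) (setIidPl cAX) mulnC; apply/leqif_refl.
suff lt : (#|X| * #|'C_A(X)| < #|A| * #|'C_X(A)|)%N.
  by split; [exact: ltnW | exact: ltn_eqF].
have sYX : 'C_X[a] \subset X := subsetIl _ _.
have prY : 'C_X[a] \proper X.
  by rewrite properE sYX subsetI subxx sub_cent1.
have ltY := index_mul_cent_lt abX nAX coAX Aa ncXa.
have leY : (#|'C_X[a]| * #|'C_A('C_X[a])| <= #|A| * #|'C_('C_X[a])(A)|)%N.
  apply: (IHn 'C_X[a]%G _ _ _ _).1.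
  - exact: leq_trans (proper_card prY) leXn.
  - exact: abelianS abX.
  - exact: subset_trans nAX.
  - exact: coprimegS coAX.
have sCaA : 'C(A) \subset 'C[a] by rewrite sub_cent1 (subsetP _ _ Aa) // centsC.
have YA : 'C_('C_X[a])(A) = 'C_X(A) by rewrite -setIA (setIidPr sCaA).
rewrite -YA; apply: leq_trans leY.
by rewrite -(Lagrange sYX) -mulnA ltn_pmul2l ?cardG_gt0.
Qed.

(** The bound is uniform in X, and its equality case determines X: equality in
    coprime_abelian_cent_leqif puts X inside 'C_B(A), and equality in
    |'C_X(A)| <= |'C_B(A)| gives the other inclusion. *)
Lemma complement_cent_leqif (gT : finGroupType) (A B X : {group gT}) :
    abelian B -> B \subset 'N(A) -> coprime #|A| #|B| -> X \subset B ->
  (#|X| * #|'C_A(X)| <= #|A| * #|'C_B(A)| ?= iff (X == 'C_B(A) :> {set gT}))%N.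
Proof.
move=> abB nAB coAB sXB.
have leX : (#|X| * #|'C_A(X)| <= #|A| * #|'C_X(A)| ?= iff (A \subset 'C(X)))%N.
  apply: coprime_abelian_cent_leqif.
  - exact: abelianS abB.
  - exact: subset_trans nAB.
  - exact: coprimegS coAB.
have leXB : (#|A| * #|'C_X(A)| <= #|A| * #|'C_B(A)| ?= iff ('C_B(A) \subset X))%N.
  split; first by rewrite leq_pmul2l ?cardG_gt0 // subset_leq_card ?setSI.
  rewrite eqn_pmul2l ?cardG_gt0 // eqn_leq subset_leq_card ?setSI //=.
  apply/idP/idP=> [le | sCX].
    have /eqP<- : 'C_X(A) == 'C_B(A) by rewrite eqEcard setSI.
    exact: subsetIl.
  by rewrite subset_leq_card // subsetI sCX subsetIr.
have -> : (X == 'C_B(A) :> {set gT}) = (A \subset 'C(X)) && ('C_B(A) \subset X).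
  by rewrite eqEsubset subsetI sXB centsC.
exact: leqif_trans leX leXB.
Qed.

(** When B is a complement to a normal subgroup A, the subgroup B :&: (A <*> H)
    represents the image of H modulo A. *)
Lemma mul_cap_joing (gT : finGroupType) (A B H : {group gT}) :
    A <*> H \subset A * B -> A * (B :&: (A <*> H)) = A <*> H.
Proof. by move=> sHAB; rewrite group_modl ?joing_subl //; apply/setIidPr. Qed.

Lemma card_cap_joing (gT : finGroupType) (A B H : {group gT}) :
    coprime #|A| #|B| -> H \subset 'N(A) -> A <*> H \subset A * B ->
  #|H| = (#|B :&: (A <*> H)| * #|A :&: H|)%N.
Proof.
move=> coAB nAH sHAB; apply/eqP; rewrite -(eqn_pmul2l (cardG_gt0 A)) mul_cardG.
rewrite -norm_joinEr // -{1}(mul_cap_joing sHAB) coprime_cardMg ?mulnA //.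
by rewrite (coprimegS _ coAB) ?subsetIl.
Qed.

(** A acts trivially on its subgroup A :&: H, so an element of A <*> K acts on it
    as an element of K does, that is, trivially. *)
Lemma cap_sub_cent_cap_joing (gT : finGroupType) (A B H K : {group gT}) :
    abelian A -> K \subset 'C(H) -> A :&: H \subset 'C_A(B :&: (A <*> K)).
Proof.
move=> abA cHK; rewrite subsetI subsetIl centsC subIset //.
rewrite join_subG (centsS _ abA) ?subsetIl // (subset_trans cHK) ?orbT //.
by rewrite centS ?subsetIr.
Qed.

(** Regrouping |H| |'C_G(H)| crosswise pairs the image of H with the A-part of
    its centraliser and vice versa; complement_cent_leqif bounds each pair. *)
Lemma cd_measure_le_cap_joing (gT : finGroupType) (G A B H : {group gT}) :
    A * B = G -> abelian A -> abelian B -> coprime #|A| #|B| -> A <| G ->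
    H \subset G ->
  (cd_measure G H <= (#|A| * #|'C_B(A)|) ^ 2)%N /\
  (cd_measure G H = (#|A| * #|'C_B(A)|) ^ 2 ->
   B :&: (A <*> H) = 'C_B(A) /\ B :&: (A <*> 'C_G(H)) = 'C_B(A))%N.
Proof.
move=> defG abA abB coAB /andP[sAG nAG] sHG.
have sBG : B \subset G by rewrite -defG mulG_subr.
have nAB := subset_trans sBG nAG.
have sAB (L : {group gT}) : L \subset G -> A <*> L \subset A * B.
  by move=> sLG; rewrite defG join_subG sAG.
pose K := 'C_G(H)%G; have sKG : K \subset G := subsetIl _ _.
have cHK : K \subset 'C(H) := subsetIr _ _.
pose X := (B :&: (A <*> H))%G; pose Y := (B :&: (A <*> K))%G.
have leX := complement_cent_leqif abB nAB coAB (subsetIl _ _ : X \subset B).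
have leY := complement_cent_leqif abB nAB coAB (subsetIl _ _ : Y \subset B).
have sHA : A :&: H \subset 'C_A(Y) by apply: cap_sub_cent_cap_joing.
have sKA : A :&: K \subset 'C_A(X).
  by apply: cap_sub_cent_cap_joing; rewrite // centsC.
have oH : #|H| = (#|X| * #|A :&: H|)%N.
  by apply: card_cap_joing; rewrite ?sAB ?(subset_trans sHG).
have oK : #|K| = (#|Y| * #|A :&: K|)%N.
  by apply: card_cap_joing; rewrite ?sAB ?(subset_trans sKG).
have leXY := leqif_mul leX leY.
have le1 : (cd_measure G H <= #|X| * #|'C_A(X)| * (#|Y| * #|'C_A(Y)|))%N.
  rewrite /cd_measure oH oK mulnACA [leqRHS]mulnACA leq_mul // mulnC.
  by rewrite leq_mul ?subset_leq_card.
split; first exact: leq_trans le1 leXY.1.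
move=> eqm; have := geq_leqif leXY.
rewrite -[(_ * _ * (_ * _))%N in leqLHS]/((_ * _) ^ 2)%N -eqm le1.
case/esym/orP=> [| /andP[/eqP eX /eqP eY]]; last by [].
by rewrite !muln_eq0 !eqn0Ngt !cardG_gt0.
Qed.

Lemma cd_measure_leqif (gT : finGroupType) (G A B H : {group gT}) :
    A * B = G -> abelian A -> abelian B -> coprime #|A| #|B| -> A <| G ->
    H \subset G ->
  (cd_measure G H <= (#|A| * #|'C_B(A)|) ^ 2
      ?= iff (H == (A * 'C_B(A))%g :> {set gT}))%N.
Proof.
move=> defG abA abB coAB nsAG sHG; have [sAG nAG] := andP nsAG.
have [leH eqH] := cd_measure_le_cap_joing defG abA abB coAB nsAG sHG.
set C := 'C_B(A) in leH eqH *; pose M := (A <*> C)%G.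
have cAC : C \subset 'C(A) := subsetIr _ _.
have defM : A * C = M by rewrite -cent_joinEr.
have abM : abelian M.
  by rewrite /= abelianY abA cAC (abelianS _ abB) ?subsetIl.
have oM : #|M| = (#|A| * #|C|)%N.
  by rewrite -defM coprime_cardMg ?(coprimegS _ coAB) ?subsetIl.
split=> //; rewrite -oM in leH eqH *; rewrite defM.
apply/eqP/eqP=> [/[dup] eqm /eqH[eX eY] | eHM].
  (* H and its centraliser lie in M, and the product of their orders is |M|^2. *)
  have sM (L : {group gT}) : L \subset G -> B :&: (A <*> L) = C -> L \subset M.
    move=> sLG eL; rewrite -defM -eL mul_cap_joing ?joing_subr //.
    by rewrite defG join_subG sAG.
  have := leqif_mul (subset_leqif_cards (sM H sHG eX))
                    (subset_leqif_cards (sM 'C_G(H)%G (subsetIl _ _) eY)).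
  case=> _; rewrite [X in X == _]eqm eqxx => /esym/orP[|/andP[/eqP//]].
  by rewrite muln_eq0 eqn0Ngt cardG_gt0.
(* As M is abelian, |M| <= |'C_G(M)|; leH is the reverse inequality. *)
apply/eqP; rewrite eqn_leq leH /cd_measure eHM leq_mul2l.
by rewrite subset_leq_card ?orbT // subsetI -{1}eHM sHG.
Qed.

Theorem theorem3 (gT : finGroupType) (G A B : {group gT})
    (sAG : A \subset G) (sBG : B \subset G) (defG : A * B = G :> {set gT})
    (abA : abelian A) (abB : abelian B) (coAB : coprime #|A| #|B|)
    (nAG : A <| G) :
  cd_max G = (#|A| ^ 2 * #|'C_B(A)| ^ 2)%N /\
  [set gval H | H in cd_lattice G] = [set A * 'C_B(A)].
Proof.
pose M := (A <*> 'C_B(A))%G.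
have defM : A * 'C_B(A) = M by rewrite -cent_joinEr ?subsetIr.
have sMG : M \subset G by rewrite join_subG sAG subIset ?sBG.
have le H := @cd_measure_leqif gT G A B H defG abA abB coAB nAG.
have mM : cd_measure G M = ((#|A| * #|'C_B(A)|) ^ 2)%N.
  by apply/eqP; rewrite (eq_leqif (le M sMG)) defM.
have maxG : cd_max G = ((#|A| * #|'C_B(A)|) ^ 2)%N.
  apply/eqP; rewrite eqn_leq; apply/andP; split.
    by apply/bigmax_leqP=> H /le[].
  by rewrite -mM (bigmax_sup M).
split; first by rewrite maxG expnMn.
apply/setP=> S; rewrite inE; apply/imsetP/eqP=> [[H] | ->].
  by rewrite inE maxG => /andP[sHG]; rewrite (eq_leqif (le H sHG)) => /eqP-> ->.
by exists M => //; rewrite inE sMG mM maxG eqxx.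
Qed.
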